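(* Let \(\theta(z)=e^{zN}.F_\infty\) be an admissible nilpotent orbit in \(\mathcal M\), let \(F_o\in\mathcal M\) be such that \((F_o,W)\) is split over \(\mathbb R\), and set \(Y_o=Y_{(F_o,W)}\). Let \(h:(a,\infty)\to H\) be a differentiable function such that for all \(y\): (a) \(Gr(h(y))\) maps the filtration induced by \(F_o\) on \(Gr^W\) to the filtration induced by \(\theta(iy)\) on \(Gr^W\), and \(\mathrm{Ad}(h(y))Y_o=Y_{(\theta(iy),W)}\); (b) \(h^{-1}(y)\frac{dh}{dy}\in\mathfrak h\cap(\eta_+\oplus\Lambda\oplus\eta_-)\). Then \[h^{-1}(y)\frac{d}{dy}h(y)=-L\,\mathrm{Ad}(h^{-1}(y))N.\]
   Context: \(V_{\mathbb Q}\) finite-dimensional over \(\mathbb Q\), \(V=V_{\mathbb Q}\otimes\mathbb C\), \(W\) an increasing rational filtration, \(Q=\{Q_k\}\) nondegenerate rational bilinear forms on \(Gr^W_k\) of parity \((-1)^k\). \(\mathcal M\) is the set of decreasing filtrations \(F\) (fixed \(\dim F^p\)) such that \((F,W)\) is a mixed Hodge structure graded-polarized by \(Q\). \(G=\{g\in GL(V):g\text{ preserves }W,\ Gr(g)\text{ real automorphism of }Q\}\), \(G_{\mathbb C}\) analogous with complex automorphisms, \(\check{\mathcal M}\) the \(G_{\mathbb C}\)-orbit of \(\mathcal M\), \(\mathfrak g_{\mathbb C}=\mathrm{Lie}(G_{\mathbb C})\), \(\mathfrak g_{\mathbb R}\) the real elements of \(\mathrm{Lie}(G)\). \(H=\{g\in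 G: g\text{ induces real automorphisms of }W_k/W_{k-2}\ \forall k\}\), \(\mathfrak h=\mathrm{Lie}(H)\). Deligne bigrading of a mixed Hodge structure \((F,W')\): unique \(V=\bigoplus I^{p,q}\) with \(F^p=\bigoplus_{a\ge p}I^{a,b}\), \(W'_k=\bigoplus_{a+b\le k}I^{a,b}\), \(\overline{I^{p,q}}\equiv I^{q,p}\bmod\bigoplus_{r<q,s<p}I^{r,s}\); split over \(\mathbb R\) if equality; \(Y_{(F,W')}\) acts as \(p+q\) on \(I^{p,q}\). With respect to \((F_o,W)\), \(\mathfrak g^{r,s}_{\mathbb C}\) = elements of \(\mathfrak g_{\mathbb C}\) mapping \(I^{p,q}\) to \(I^{p+r,q+s}\), and \(\mathfrak g_{\mathbb C}=\eta_+\oplus\eta_0\oplus\eta_-\oplus\Lambda\) with \(\eta_+=\bigoplus_{r\ge0,s<0}\mathfrak g^{r,s}_{\mathbb C}\), \(\eta_0=\mathfrak g^{0,0}_{\mathbb C}\), \(\eta_-=\bigoplus_{r<0,s\ge0}\mathfrak g^{r,s}_{\mathbb C}\), \(\Lambda=\bigoplus_{r,s<0}\mathfrak g^{r,s}_{\mathbb C}\). \(L\) is the endomorphism acting as \(+i\) on \(\eta_+\), \(0\) on \(\eta_0\), \(-i\) on \(\eta_-\oplus\Lambda\). Admissible nilpotent orbit: \(\theta(z)=e^{zN}.F_\infty\) with \(F_\infty\in\check{\mathcal M}\), \(N\in\mathfrak g_{\mathbb R}\) nilpotent, \(N(F_\infty^p)\subset F_\infty^{p-1}\), \(\theta(z)\in\mathcal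 M\) for \(\mathrm{Im}\,z\gg0\) (in particular for \(z=iy\), \(y>a\)), and the relative weight filtration \({}^rW(N,W)\) exists. *)

(* Defs.v *)
From HB Require Import structures.
From mathcomp Require Import all_boot all_order all_algebra.
From mathcomp Require Import complex.
From mathcomp Require Import reals topology normedtype derive.
Import GRing.Theory Num.Theory numFieldNormedType.Exports.

Set Implicit Arguments.
Unset Strict Implicit.
Unset Printing Implicit Defensive.

Local Open Scope ring_scope.

(* Conventions.
   V = C^n with C = R[i] (R a real field), V_Q = Q^n (the standard rational structure).
   Vectors are row vectors 'rV_n; a subspace is the row space of a square matrix (mxalgebra, %MS).
   An endomorphism T of V is represented by its usual matrix X acting on COLUMN vectors, so that
   composition is matrix product and Ad(g)X = g X g^-1; on a row vector v it acts as v *m X^T,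
   and on a subspace U (row space) as U *m X^T (see [act]).
   Increasing/decreasing filtrations are families of subspaces indexed by int. *)

Section Defs.
Variable R : realType.
Variable n : nat.
Local Notation C := (R[i]).
Local Notation mx := 'M[C]_n.

Definition iC : C := Complex 0 1.

Definition conjm m k (A : 'M[C]_(m, k)) : 'M[C]_(m, k) := map_mx (@conjc R) A.

Definition act (X : mx) (U : mx) : mx := U *m X^T.

Definition zrange (K : nat) : seq int := [seq (i%:Z - K%:Z)%R | i <- iota 0 (K.*2).+1].

Definition rational_mx m k (B : 'M[C]_(m, k)) : Prop :=
  forall i j, exists q : rat, B i j = ratr q.

Definition rational_subspace (U : mx) : Prop :=
  exists m (B : 'M[C]_(m, n)), rational_mx B /\ (U == B)%MS.

Definition incr_filtration (W : int -> mx) : Prop :=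
  (forall k, (W (k - 1)%R <= W k)%MS) /\
  exists K : nat, forall k : int,
    ((k <= - K%:Z)%R -> (W k <= (0 : mx))%MS) /\ ((K%:Z <= k)%R -> (1%:M <= W k)%MS).

Definition decr_filtration (F : int -> mx) : Prop :=
  (forall p, (F (p + 1)%R <= F p)%MS) /\
  exists P : nat, forall p : int,
    ((p <= - P%:Z)%R -> (1%:M <= F p)%MS) /\ ((P%:Z <= p)%R -> (F p <= (0 : mx))%MS).

Definition rational_weight_filtration (W : int -> mx) : Prop :=
  incr_filtration W /\ forall k, rational_subspace (W k).

Definition bil (S : mx) (u v : 'rV[C]_n) : C := (u *m S *m v^T) 0 0.

(* Q = {Q_k}: Q_k is a rational bilinear form on Gr^W_k = W_k / W_(k-1), represented by a
   rational matrix S k whose restriction to W_k has radical exactly W_(k-1)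
   (so it descends to a nondegenerate form on Gr^W_k), of parity (-1)^k. *)
Definition graded_forms (W : int -> mx) (S : int -> mx) : Prop :=
  (forall k, rational_mx (S k)) /\
  (forall k u v, (u <= W k)%MS -> (v <= W k)%MS ->
       bil (S k) v u = (-1) ^ k * bil (S k) u v) /\
  (forall k u, (u <= W k)%MS ->
       ((forall v, (v <= W k)%MS -> bil (S k) u v = 0) <-> (u <= W (k - 1)%R)%MS)).

(* F is in \mathcal M: (F,W) is a mixed Hodge structure graded-polarized by Q, with dim F^p = fdim p.
   On Gr^W_k the induced filtration is F^p Gr^W_k = (F^p \cap W_k + W_(k-1)) / W_(k-1).  *)
Definition in_M (W S : int -> mx) (fdim : int -> nat) (F : int -> mx) : Prop :=
  decr_filtration F /\
  (forall p, \rank (F p) = fdim p) /\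
  forall k p : int,
    let A := fun q => (F q :&: W k + W (k - 1)%R)%MS in
    (* pure Hodge structure of weight k on Gr^W_k: Gr = F^p (+) conj F^(k-p+1) *)
    (A p + conjm (A (k - p + 1)%R) == W k)%MS /\
    (A p :&: conjm (A (k - p + 1)%R) == W (k - 1)%R)%MS /\
    (forall u v, (u <= F p :&: W k)%MS -> (v <= F (k - p + 1)%R :&: W k)%MS ->
        bil (S k) u v = 0) /\
    (* second Hodge-Riemann relation: i^(p-q) Q_k(v, conj v) > 0 on nonzero v in H^{p,q}, q = k-p *)
    (forall v, (v <= A p :&: conjm (A (k - p)%R))%MS -> ~~ (v <= W (k - 1)%R)%MS ->
        0 < iC ^ (p - (k - p)%R) * bil (S k) v (conjm v)).

Definition preservesW (W : int -> mx) (X : mx) : Prop :=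
  forall k, (act X (W k) <= W k)%MS.

(* the map induced by X on W_k / W_(k-j) is real, for all k *)
Definition real_mod (W : int -> mx) (j : int) (X : mx) : Prop :=
  forall k, (act (X - conjm X) (W k) <= W (k - j)%R)%MS.

Definition preservesQ (W S : int -> mx) (g : mx) : Prop :=
  forall k u v, (u <= W k)%MS -> (v <= W k)%MS ->
    bil (S k) (u *m g^T) (v *m g^T) = bil (S k) u v.

Definition inG_C (W S : int -> mx) (g : mx) : Prop :=
  g \in unitmx /\ preservesW W g /\ preservesQ W S g.
Definition inG (W S : int -> mx) (g : mx) : Prop :=
  inG_C W S g /\ real_mod W 1 g.
Definition inH (W S : int -> mx) (g : mx) : Prop :=
  inG W S g /\ real_mod W 2 g.

Definition in_gC (W S : int -> mx) (X : mx) : Prop :=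
  preservesW W X /\
  forall k u v, (u <= W k)%MS -> (v <= W k)%MS ->
    bil (S k) (u *m X^T) v + bil (S k) u (v *m X^T) = 0.
Definition in_LieG (W S : int -> mx) (X : mx) : Prop :=
  in_gC W S X /\ real_mod W 1 X.
Definition in_gR (W S : int -> mx) (X : mx) : Prop :=
  in_LieG W S X /\ conjm X = X.
Definition in_h (W S : int -> mx) (X : mx) : Prop :=
  in_LieG W S X /\ real_mod W 2 X.

Definition deligne_bigrading (F W' : int -> mx) (I : int -> int -> mx) : Prop :=
  exists K : nat,
    (forall p q, ((K%:Z < `|p|)%R || (K%:Z < `|q|)%R) -> (I p q <= (0 : mx))%MS) /\
    (\sum_(p <- zrange K) \sum_(q <- zrange K) I p q == 1%:M)%MS /\
    \rank (\sum_(p <- zrange K) \sum_(q <- zrange K) I p q)%MS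
      = (\sum_(p <- zrange K) \sum_(q <- zrange K) \rank (I p q))%N /\
    (forall p, (F p == \sum_(a <- zrange K | (p <= a)%R) \sum_(b <- zrange K) I a b)%MS) /\
    (forall k, (W' k == \sum_(a <- zrange K) \sum_(b <- zrange K | (a + b <= k)%R) I a b)%MS) /\
    (forall p q,
       let L := (\sum_(r <- zrange K | (r < q)%R) \sum_(s <- zrange K | (s < p)%R) I r s)%MS in
       (conjm (I p q) + L == I q p + L)%MS).

Definition split_over_R (I : int -> int -> mx) : Prop :=
  forall p q, (conjm (I p q) == I q p)%MS.

Definition grading_Y (I : int -> int -> mx) (Y : mx) : Prop :=
  forall p q (v : 'rV[C]_n), (v <= I p q)%MS -> v *m Y^T = (p + q)%:~R *: v.

Definition is_Y (F W' : int -> mx) (Y : mx) : Prop :=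
  exists I, deligne_bigrading F W' I /\ grading_Y I Y.

Definition in_grs (W S : int -> mx) (I : int -> int -> mx) (r s : int) (X : mx) : Prop :=
  in_gC W S X /\ forall p q, (act X (I p q) <= I (p + r)%R (q + s)%R)%MS.

Definition rs_decomposition (W S : int -> mx) (I : int -> int -> mx)
    (X : mx) (K : nat) (D : int -> int -> mx) : Prop :=
  (forall r s, ((K%:Z < `|r|)%R || (K%:Z < `|s|)%R) -> D r s = 0) /\
  (forall r s, in_grs W S I r s (D r s)) /\
  X = \sum_(r <- zrange K) \sum_(s <- zrange K) D r s.

(* eigenvalue of L on g^{r,s}: +i on eta_+ (r>=0,s<0), 0 on eta_0, -i on eta_- (+) Lambda (r<0).
   (g^{r,s} = 0 for r+s>0, since g_C preserves W.) *)
Definition Lcoef (r s : int) : C :=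
  if (0 <= r)%R && (s < 0)%R then iC else if (r < 0)%R then - iC else 0.

Definition L_image (W S : int -> mx) (I : int -> int -> mx) (X Z : mx) : Prop :=
  exists K D, rs_decomposition W S I X K D /\
    Z = \sum_(r <- zrange K) \sum_(s <- zrange K) Lcoef r s *: D r s.

Definition in_eta_sum (W S : int -> mx) (I : int -> int -> mx) (X : mx) : Prop :=
  exists K D, rs_decomposition W S I X K D /\
    forall r s, ~~ (((0 <= r)%R && (s < 0)%R) || (r < 0)%R) -> D r s = 0.

(* exponential of a nilpotent matrix (the series terminates at n) *)
Definition mexp (X : mx) : mx := \sum_(k < n.+1) (k`!%:R)^-1 *: X ^+ k.

Definition theta (N : mx) (Finf : int -> mx) (z : C) : int -> mx :=
  fun p => act (mexp (z *: N)) (Finf p).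

Definition relative_weight (N : mx) (W Mr : int -> mx) : Prop :=
  incr_filtration Mr /\
  (forall k, (act N (Mr k) <= Mr (k - 2)%R)%MS) /\
  forall (k : int) (l : nat),
    let A := fun j => (Mr j :&: W k + W (k - 1)%R)%MS in
    let B := fun j => (Mr (j - 1)%R :&: W k + W (k - 1)%R)%MS in
    (* N^l : Gr^M_{k+l} Gr^W_k -> Gr^M_{k-l} Gr^W_k is injective ... *)
    (forall v : 'rV[C]_n, (v <= A (k + l%:Z)%R)%MS ->
        (v *m (N ^+ l)^T <= B (k - l%:Z)%R)%MS -> (v <= B (k + l%:Z)%R)%MS) /\
    (* ... and surjective *)
    (A (k - l%:Z)%R <= act (N ^+ l) (A (k + l%:Z)%R) + B (k - l%:Z)%R)%MS.

Definition admissible_orbit (W S : int -> mx) (fdim : int -> nat) (N : mx) (Finf : int -> mx)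
  : Prop :=
  (exists g F, inG_C W S g /\ in_M W S fdim F /\ forall p, (Finf p == act g (F p))%MS) /\
  in_gR W S N /\ (exists m, N ^+ m = 0) /\
  (forall p, (act N (Finf p) <= Finf (p - 1)%R)%MS) /\
  (exists b : R, forall z : C, b < complex.Im z -> in_M W S fdim (theta N Finf z)) /\
  (exists Mr, relative_weight N W Mr).

Definition has_deriv (h : R -> mx) (y : R) (D : mx) : Prop :=
  forall i j,
    is_derive y 1 (fun t => complex.Re (h t i j)) (complex.Re (D i j)) /\
    is_derive y 1 (fun t => complex.Im (h t i j)) (complex.Im (D i j)).

End Defs.

(* Main.v *)
(** Write X = h^-1 h', A = Ad(h^-1) N, and fix bidegrees (r, s) with respect to the
    Deligne bigrading I of (F_o, W), which conjugation swaps because it is split over R.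

    Hypothesis (a) says that h carries I onto the Deligne bigrading of theta(iy): the
    Y-eigenspaces lift Gr^W, and Gr(h) is real and respects the filtrations.  Hence
    h F_o = e^(iyN) F_oo, and differentiating the curve e^(-iyN) h, which maps F_o to the
    constant filtration F_oo, shows that X - iA preserves F_o: it has only components with
    r >= 0.

    The congruence for the conjugates of the Deligne bigrading says that u = h^-1 conj(h)
    lies in 1 + Lambda, so u' = u conj(X) - X u lies in Lambda.  Since u^-1 = conj(u) and
    A = u conj(A) u^-1, we get X + iA = u conj(X - iA) u^-1 - u' u^-1, where
    conj(X - iA) has only components with s >= 0 >= r + s; so X + iA has no component with
    r >= 0 > s.  Together with X^(0,0) = 0 this is X = -L A.  The components of A of
    bidegree other than (0,0) are thereby multiples of those of X, hence lie in g_C, and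
    so does the remaining one. *)
Require Import Defs.
From HB Require Import structures.
From mathcomp Require Import all_boot all_order all_algebra.
From mathcomp Require Import complex.
From mathcomp Require Import reals topology normedtype derive.
From mathcomp Require Import ring zify.
Import Order.TTheory GRing.Theory Num.Theory numFieldNormedType.Exports.
Local Open Scope ring_scope.

(** * Derivatives of complex-valued functions of a real variable *)

Section ComplexCurves.
Context {R : realType}.
Implicit Types (f g : R -> R[i]) (y t : R) (d e c : R[i]).

(** This is the condition that [has_deriv] imposes on each matrix entry, so the rules below apply to
    entries by conversion. *)
Definition cderiv f y d :=
  is_derive y (1 : R) (fun t => complex.Re (f t)) (complex.Re d) /\
  is_derive y (1 : R) (fun t => complex.Im (f t)) (complex.Im d).

Definition cderivable f y := exists d, cderiv f y d.

Lemma is_derive_ext (f g : R -> R) y (d e : R) :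
  (forall t, f t = g t) -> d = e -> is_derive y 1 f d -> is_derive y 1 g e.
Proof.
move=> fg de df; rewrite -de; apply: near_eq_is_derive df.
exact: filterE.
Qed.

Lemma cderiv_ext f g y d e :
  (forall t, f t = g t) -> d = e -> cderiv f y d -> cderiv g y e.
Proof.
by move=> fg -> [fr fi]; split;
  [apply: is_derive_ext fr | apply: is_derive_ext fi] => // t; rewrite fg.
Qed.

Lemma cderiv_cst c y : cderiv (fun=> c) y 0.
Proof. by split; exact: is_derive_cst. Qed.

Lemma ReD d e : complex.Re (d + e) = complex.Re d + complex.Re e.
Proof. by case: d e => ? ? []. Qed.

Lemma ImD d e : complex.Im (d + e) = complex.Im d + complex.Im e.
Proof. by case: d e => ? ? []. Qed.

Lemma ReM d e : complex.Re (d * e) =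
  complex.Re d * complex.Re e - complex.Im d * complex.Im e.
Proof. by case: d e => ? ? []. Qed.

Lemma ImM d e : complex.Im (d * e) =
  complex.Re d * complex.Im e + complex.Im d * complex.Re e.
Proof. by case: d e => ? ? []. Qed.

Lemma ReV d : complex.Re d^-1 = complex.Re d /
  (complex.Re d * complex.Re d + complex.Im d * complex.Im d).
Proof. by case: d => u v /=; rewrite -!expr2. Qed.

Lemma ImV d : complex.Im d^-1 = - (complex.Im d /
  (complex.Re d * complex.Re d + complex.Im d * complex.Im d)).
Proof. by case: d => u v /=; rewrite -!expr2. Qed.

Lemma cderivD f g y d e :
  cderiv f y d -> cderiv g y e -> cderiv (fun t => f t + g t) y (d + e).
Proof.
move=> [fr fi] [gr gi]; split.
- by apply: is_derive_ext (is_deriveD fr gr) => [t|]; rewrite ReD.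
- by apply: is_derive_ext (is_deriveD fi gi) => [t|]; rewrite ImD.
Qed.

Lemma cderivM f g y d e :
  cderiv f y d -> cderiv g y e ->
  cderiv (fun t => f t * g t) y (d * g y + f y * e).
Proof.
move=> [fr fi] [gr gi]; split.
- apply: is_derive_ext (is_deriveB (is_deriveM fr gr) (is_deriveM fi gi)) => [t|].
    by rewrite ReM.
  by rewrite ReD !ReM /GRing.scale /=; ring.
- apply: is_derive_ext (is_deriveD (is_deriveM fr gi) (is_deriveM fi gr)) => [t|].
    by rewrite ImM.
  by rewrite ImD !ImM /GRing.scale /=; ring.
Qed.

(** Existence is enough here: the value of the derivative of an inverse matrix is recovered in
    [has_deriv_inv] by differentiating [h h^-1 = 1]. *)
Lemma cderivable_inv f y : f y != 0 -> cderivable f y ->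
  cderivable (fun t => (f t)^-1) y.
Proof.
move=> fy0 [d [fr fi]].
(* The squared modulus of [f], the common denominator of both parts of [f^-1]. *)
pose q := fun t => complex.Re (f t) * complex.Re (f t) +
                   complex.Im (f t) * complex.Im (f t).
have qy0 : q y != 0.
  apply: contra fy0; rewrite /q -!expr2 paddr_eq0 ?sqr_ge0// !sqrf_eq0.
  by case: (f y) => u v /= /andP[/eqP-> /eqP->].
have [qd qV] : derivable q y 1 /\ derivable (fun t => (q t)^-1) y 1.
  suff qd : derivable q y 1 by split => //; apply: derivableV.
  by case: (is_deriveD (is_deriveM fr fr) (is_deriveM fi fi)).
have /derivableP dV := qV.
have rV := is_deriveM fr dV; have iV := is_deriveN (is_deriveM fi dV).
eexists (Complex _ _); split; [apply: is_derive_ext rV | apply: is_derive_ext iV].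
2,4: by [].
  by move=> t; rewrite ReV.
by move=> t; rewrite ImV.
Qed.

Lemma cderivable_sum (I : Type) (r : seq I) (P : pred I) (F : I -> R -> R[i]) y :
  (forall i, cderivable (F i) y) ->
  cderivable (fun t => \sum_(i <- r | P i) F i t) y.
Proof.
move=> dF; elim: r => [|i r [d IH]].
  by exists 0; apply: cderiv_ext (cderiv_cst 0 y) => // t; rewrite big_nil.
case Pi: (P i); last first.
  by exists d; apply: cderiv_ext IH => // t; rewrite big_cons Pi.
have [e dFi] := dF i; exists (e + d).
by apply: cderiv_ext (cderivD _ _ _ _ _ dFi IH) => // t; rewrite big_cons Pi.
Qed.

Lemma cderivable_prod (I : Type) (r : seq I) (P : pred I) (F : I -> R -> R[i]) y :
  (forall i, cderivable (F i) y) ->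
  cderivable (fun t => \prod_(i <- r | P i) F i t) y.
Proof.
move=> dF; elim: r => [|i r [d IH]].
  by exists 0; apply: cderiv_ext (cderiv_cst 1 y) => // t; rewrite big_nil.
case Pi: (P i); last first.
  by exists d; apply: cderiv_ext IH => // t; rewrite big_cons Pi.
have [e dFi] := dF i; eexists.
by apply: cderiv_ext (cderivM _ _ _ _ _ dFi IH) => // t; rewrite big_cons Pi.
Qed.

Lemma cderivableM f g y : cderivable f y -> cderivable g y ->
  cderivable (fun t => f t * g t) y.
Proof. by move=> [d df] [e dg]; eexists; apply: cderivM df dg. Qed.

Lemma cderivable_cst c y : cderivable (fun=> c) y.
Proof. by exists 0; exact: cderiv_cst. Qed.

Lemma cderiv_near f g y d :
  (\near y, f y = g y) -> cderiv f y d -> cderiv g y d.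
Proof.
move=> fg [fr fi]; split.
- apply: near_eq_is_derive fr; apply: filterS fg => t /= -> //.
- by apply: near_eq_is_derive fi; apply: filterS fg => t /= ->.
Qed.

Lemma cderiv_uniq f y d e : cderiv f y d -> cderiv f y e -> d = e.
Proof.
case: d e => [a b] [c d] [/= fr fi] [/= gr gi]; congr Complex.
  by rewrite -(@derive_val _ _ _ _ _ _ _ fr) -(@derive_val _ _ _ _ _ _ _ gr).
by rewrite -(@derive_val _ _ _ _ _ _ _ fi) -(@derive_val _ _ _ _ _ _ _ gi).
Qed.

Lemma cderiv_conj f y d : cderiv f y d -> cderiv (fun t => conjc (f t)) y (conjc d).
Proof.
move=> [fr fi]; split.
  by apply: is_derive_ext fr; [move=> t; case: (f t)|case: (d)].
have ImJ (z : R[i]) : complex.Im (conjc z) = - complex.Im z by case: z.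
by apply: is_derive_ext (is_deriveN fi) => [t|]; rewrite ImJ.
Qed.

Lemma cderivable_det n (h : R -> 'M[R[i]]_n) y :
  (forall i j, cderivable (fun t => h t i j) y) -> cderivable (fun t => \det (h t)) y.
Proof.
move=> dh; rewrite /determinant; apply: cderivable_sum => s.
apply: cderivableM; first exact: cderivable_cst.
exact: cderivable_prod.
Qed.

End ComplexCurves.

(** * Derivatives of matrix-valued curves *)

Section MatrixCurves.
Context {R : realType} {n : nat}.
Implicit Types (h g : R -> 'M[R[i]]_n) (y : R) (D E : 'M[R[i]]_n).

Lemma has_deriv_near {h g y D} :
  (\near y, h y = g y) -> has_deriv h y D -> has_deriv g y D.
Proof.
move=> hg dh i j; apply: (cderiv_near (fun t => h t i j)) (dh i j).
by apply: filterS hg => t /= ->.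
Qed.

Lemma has_deriv_uniq {h y D E} : has_deriv h y D -> has_deriv h y E -> D = E.
Proof. by move=> dD dE; apply/matrixP => i j; apply: cderiv_uniq (dD i j) (dE i j). Qed.

Lemma has_deriv_cst D y : has_deriv (fun=> D) y 0.
Proof. by move=> i j; rewrite mxE; apply: (cderiv_cst (D i j)). Qed.

Lemma has_derivD {h g y D E} : has_deriv h y D -> has_deriv g y E ->
  has_deriv (fun t => h t + g t) y (D + E).
Proof.
move=> dh dg i j; apply: cderiv_ext (cderivD _ _ _ _ _ (dh i j) (dg i j)).
  by move=> t; rewrite mxE.
by rewrite mxE.
Qed.

Lemma has_derivM {h g y D E} : has_deriv h y D -> has_deriv g y E ->
  has_deriv (fun t => h t *m g t) y (D *m g y + h y *m E).
Proof.
move=> dh dg i j.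
suff H (r : seq 'I_n) : cderiv (fun t => \sum_(k <- r) h t i k * g t k j) y
    (\sum_(k <- r) (D i k * g y k j + h y i k * E k j)).
  apply: cderiv_ext (H _) => [t|]; first by rewrite mxE.
  by rewrite !mxE big_split.
elim: r => [|k r IH].
  by rewrite big_nil; apply: cderiv_ext (cderiv_cst 0 y) => // t; rewrite big_nil.
rewrite big_cons.
apply: cderiv_ext (cderivD _ _ _ _ _ (cderivM _ _ _ _ _ (dh i k) (dg k j)) IH) => //.
by move=> t; rewrite big_cons.
Qed.

Lemma has_deriv_tr {h y D} : has_deriv h y D -> has_deriv (fun t => (h t)^T) y D^T.
Proof.
move=> dh i j; apply: cderiv_ext (dh j i); last by rewrite mxE.
by move=> t; rewrite mxE.
Qed.

Lemma has_deriv_conj {h y D} : has_deriv h y D ->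
  has_deriv (fun t => conjm (h t)) y (conjm D).
Proof.
move=> dh i j; apply: cderiv_ext (cderiv_conj _ _ _ (dh i j)).
  by move=> t; rewrite mxE.
by rewrite mxE.
Qed.

(** Applied to products with constant matrices, this passes a linear condition on a curve to its
    derivative. *)
Lemma has_deriv_vanish {h y D} : (\near y, h y = 0) -> has_deriv h y D -> D = 0.
Proof.
move=> h0 dh; apply: (@has_deriv_uniq h y) => //.
by apply: has_deriv_near (has_deriv_cst 0 y); apply: filterS h0 => t /= ->.
Qed.

End MatrixCurves.

Lemma has_deriv_adj {R : realType} {n} {h : R -> 'M[R[i]]_n} {y : R} {D} :
  has_deriv h y D -> exists E, has_deriv (fun t => \adj (h t)) y E.
Proof.
move=> dh.
have adjd i j : cderivable (fun t => (\adj (h t)) i j) y.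
  have : cderivable (fun t => cofactor (h t) j i) y.
    apply: cderivableM; first exact: cderivable_cst.
    apply: cderivable_det => k l.
    exists (D (lift j k) (lift i l)).
    by apply: cderiv_ext (dh (lift j k) (lift i l)) => // t; rewrite !mxE.
  by move=> [d dd]; exists d; apply: cderiv_ext dd => // t; rewrite mxE.
(* Finite choice over pairs of indices collects the entrywise derivatives into one matrix. *)
have [E HE] : exists E : 'I_n * 'I_n -> R[i], forall p, cderiv (fun t => \adj (h t) p.1 p.2) y (E p).
  have [|E HE] := @fin_all_exists _ (fun=> R[i]) (fun p d => cderiv (fun t => \adj (h t) p.1 p.2) y d).
    by move=> [i j]; exact: adjd.
  by exists E.
exists (\matrix_(i, j) E (i, j)) => i j.
by apply: cderiv_ext (HE (i, j)) => //; rewrite mxE.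
Qed.

(** Near [y] the inverse is the adjugate divided by the determinant, hence differentiable; its
    derivative is then forced by the product rule for [h h^-1 = 1]. *)
Lemma has_deriv_inv {R : realType} {n} {h : R -> 'M[R[i]]_n} {y : R} {D} :
  (\near y, h y \in unitmx) -> has_deriv h y D ->
  has_deriv (fun t => invmx (h t)) y (- (invmx (h y) *m D *m invmx (h y))).
Proof.
move=> hu dh.
have uy : h y \in unitmx by exact: nbhs_singleton hu.
have [E dE] : exists E, has_deriv (fun t => invmx (h t)) y E.
  have [A dA] := has_deriv_adj dh.
  have [c dc] : cderivable (fun t => (\det (h t))^-1) y.
    apply: cderivable_inv; first by move: uy; rewrite unitmxE unitfE.
    by apply: cderivable_det => i j; exists (D i j); exact: dh.
  exists (c *: \adj (h y) + (\det (h y))^-1 *: A).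
  apply: (@has_deriv_near _ _ (fun t => (\det (h t))^-1 *: \adj (h t))).
    by apply: filterS hu => t /= ut; rewrite /invmx ut.
  move=> i j; apply: cderiv_ext (cderivM _ _ _ _ _ dc (dA i j)) => [t|]; by rewrite !mxE.
have := has_derivM dh dE.
move/(has_deriv_near (g := fun=> 1%:M)) => /(_ _)/has_deriv_uniq H.
have {H} : D *m invmx (h y) + h y *m E = 0.
  apply: H; last exact: has_deriv_cst.
  by apply: filterS hu => t /= ut; rewrite mulmxV.
move/(congr1 (mulmx (invmx (h y)))).
rewrite mulmxDr mulmx0 mulKmx// => /eqP.
by rewrite addrC addr_eq0 mulmxA => /eqP <-.
Qed.

(** * Powers and exponentials of nilpotent matrices *)

Lemma nilpotent_mx_expn (F : fieldType) n (N : 'M[F]_n) m : N ^+ m = 0 -> N ^+ n = 0.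
Proof.
move=> Nm0.
(* Once two consecutive row spaces agree, the sequence is constant from there on, and it reaches
   [N ^+ (k + m) = 0]. *)
have stable k : (N ^+ k <= N ^+ k.+1)%MS -> N ^+ k = 0.
  move=> Hk.
  have step j : (N ^+ k <= N ^+ (k + j))%MS.
    elim: j => [|j IH]; first by rewrite addn0.
    by apply: (submx_trans Hk); rewrite addnS !exprSr submxMr.
  by apply/eqP; rewrite -submx0 (submx_trans (step m))// exprD Nm0 mulr0 submx_refl.
(* Each further power loses at least one unit of rank until it vanishes; at [k = n] no rank is
   left. *)
suff H k : N ^+ k = 0 \/ (\rank (N ^+ k) + k <= n)%N.
  have [//|] := H n; rewrite -[X in (_ <= X)%N]add0n leq_add2r leqn0 => r0.
  by apply/eqP; rewrite -mxrank_eq0.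
elim: k => [|k [Nk0|IH]].
- by right; rewrite expr0 mxrank1 addn0.
- by left; rewrite exprSr Nk0 mul0r.
have [|lt] := boolP (N ^+ k <= N ^+ k.+1)%MS.
  by move/stable => Nk0; left; rewrite exprSr Nk0 mul0r.
right; rewrite addnS; apply: leq_trans IH; rewrite -addSn leq_add2r.
rewrite ltn_neqAle; have sub : (N ^+ k.+1 <= N ^+ k)%MS by rewrite exprS submxMl.
rewrite mxrankS// andbT; apply: contra lt => /eqP rk.
by rewrite -(geq_leqif (mxrank_leqif_sup sub)) rk.
Qed.

Lemma expr_scalemx (F : comPzRingType) n (z : F) (N : 'M[F]_n) k :
  (z *: N) ^+ k = z ^+ k *: N ^+ k.
Proof.
elim: k => [|k IH]; first by rewrite !expr0 scale1r.
by rewrite !exprS IH -!mulmxE -scalemxAl -scalemxAr scalerA.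
Qed.

Section Exponential.
Context {R : realType} {n : nat}.
Implicit Types (N : 'M[R[i]]_n) (y : R).

Lemma cderiv_imX k y :
  cderiv (fun t => (Complex 0 t : R[i]) ^+ k) y (k%:R * iC R * Complex 0 y ^+ k.-1).
Proof.
elim: k => [|k IH]; first by rewrite !mul0r; exact: cderiv_cst.
have d1 : cderiv (fun t => Complex 0 t : R[i]) y (iC R).
  by split; [exact: is_derive_cst|exact: is_derive_id].
apply: cderiv_ext (cderivM _ _ _ _ _ d1 IH) => [t|]; first by rewrite exprS.
case: k {IH} => [|k]; first by rewrite !mul0r mulr0 addr0 mul1r.
by rewrite /= [Complex 0 y ^+ k.+1]exprS -[k.+2%:R]natr1; ring.
Qed.

Lemma has_deriv_sum (r : seq nat) (F : nat -> R -> 'M[R[i]]_n) D y :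
  (forall k, has_deriv (F k) y (D k)) ->
  has_deriv (fun t => \sum_(k <- r) F k t) y (\sum_(k <- r) D k).
Proof.
move=> dF; elim: r => [|k r IH].
  rewrite big_nil; apply: has_deriv_near (has_deriv_cst 0 y).
  by apply: filterE => t /=; rewrite big_nil.
rewrite big_cons; apply: has_deriv_near (has_derivD (dF k) IH).
by apply: filterE => t /=; rewrite big_cons.
Qed.

(** Termwise differentiation shifts the truncated series by one index; multiplication by [N] gives
    the same terms and one more in [N ^+ n.+1], which vanishes. *)
Lemma has_deriv_mexp N y : N ^+ n.+1 = 0 ->
  has_deriv (fun t => mexp (Complex 0 t *: N)) y
            (iC R *: (N *m mexp (Complex 0 y *: N))).
Proof.
move=> N0.
pose c k : R[i] := (k`!%:R)^-1.
have dk k : has_deriv (fun t => c k *: (Complex 0 t *: N) ^+ k) y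
    ((c k * (k%:R * iC R * Complex 0 y ^+ k.-1)) *: N ^+ k).
  move=> i j.
  have := cderivM _ _ _ _ _ (cderiv_cst (c k * (N ^+ k) i j) y) (cderiv_imX k y).
  apply: cderiv_ext => [t|]; first by rewrite expr_scalemx !mxE; ring.
  by rewrite !mxE; ring.
have := has_deriv_sum (index_iota 0 n.+1) _ _ y dk.
rewrite big_mkord big_ord_recl /= !mul0r mulr0 scale0r add0r.
rewrite [X in has_deriv _ _ X](_ : _ = iC R *: (N *m mexp (Complex 0 y *: N))).
  apply: has_deriv_near.
  by apply: filterE => t /=; rewrite big_mkord.
rewrite /mexp big_ord_recr /= mulmxDr expr_scalemx -!scalemxAr mulmxE -exprS N0.
rewrite !scaler0 addr0 -mulmxE mulmx_sumr scaler_sumr; apply: eq_bigr => k _.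
rewrite expr_scalemx -!scalemxAr mulmxE -exprS !scalerA; congr (_ *: _).
rewrite /c /bump /= add1n factS natrM invfM.
have k0 : k.+1%:R != 0 :> R[i] by rewrite pnatr_eq0.
have f0 : k`!%:R != 0 :> R[i] by rewrite pnatr_eq0 -lt0n fact_gt0.
by field; rewrite f0 nat1r k0.
Qed.

End Exponential.

(** * Projectors attached to a direct sum of subspaces *)

Section DirectSums.
Context {F : fieldType} {n : nat}.

Lemma addsmx_seq_sub (I : Type) (s : seq I) (P : pred I) (U : I -> 'M[F]_n)
    m (A : 'M[F]_(m, n)) :
  (forall i, P i -> (U i <= A)%MS) -> (\sum_(i <- s | P i) U i <= A)%MS.
Proof.
move=> UA; elim/big_ind: _ => //; first exact: sub0mx.
by move=> X Y XA YA; rewrite addsmx_sub XA YA.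
Qed.

Lemma addsmx_seq_sup (I : eqType) (s : seq I) (P : pred I) (U : I -> 'M[F]_n) i
    m (A : 'M[F]_(m, n)) : i \in s -> P i -> (A <= U i)%MS ->
  (A <= \sum_(i <- s | P i) U i)%MS.
Proof.
by move=> si Pi Ai; rewrite (big_rem i)//= Pi (submx_trans Ai)// addsmxSl.
Qed.

Lemma direct_sum_projectors (I : eqType) (s : seq I) (U : I -> 'M[F]_n) :
  uniq s -> (1%:M <= \sum_(i <- s) U i)%MS ->
  \rank (\sum_(i <- s) U i)%MS = (\sum_(i <- s) \rank (U i))%N ->
  exists P : I -> 'M[F]_n,
    [/\ forall i, (P i <= U i)%MS,
        forall i, i \in s -> U i *m P i = U i,
        forall i j, i \in s -> j != i -> U i *m P j = 0 &
        \sum_(i <- s) P i = 1%:M].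
Proof.
move=> us full rk.
pose V i := (\sum_(j <- s | j != i) U j)%MS.
(* Additivity of ranks leaves no room for the intersection: [V i] has rank at most the sum of the
   other ranks, and [U i + V i] already attains the total. *)
have cap0 i : i \in s -> (U i :&: V i)%MS = 0.
  move=> si; apply/eqP; rewrite -mxrank_eq0.
  have le : (\rank (V i) <= \sum_(j <- s | j != i) \rank (U j))%N.
    rewrite /V; elim/big_ind2: _ => [|X x Y y lx ly|//]; first by rewrite mxrank0.
    by apply: leq_trans (mxrank_adds_leqif X Y) _; exact: leq_add.
  have := mxrank_sum_cap (U i) (V i).
  have -> : \rank (U i + V i)%MS = (\rank (U i) + \sum_(j <- s | j != i) \rank (U j))%N.
    by rewrite -(bigD1_seq i si us (F := fun j => \rank (U j))) -rk (bigD1_seq i si us).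
  by lia.
exists (fun i => if i \in s then proj_mx (U i) (V i) else 0); split.
- move=> i; case: ifP => _; last exact: sub0mx.
  by rewrite -[proj_mx _ _]mul1mx proj_mx_sub.
- by move=> i si; rewrite si proj_mx_id ?cap0.
- move=> i j si ji; case: ifP => sj; last by rewrite mulmx0.
  by rewrite proj_mx_0 ?cap0// /V (addsmx_seq_sup _ _ _ _ i)// eq_sym.
(* The sum of the projectors minus the identity kills every [U i], and these span the whole
   space. *)
- set P := BIG_F; apply/eqP; rewrite -subr_eq0 -[_ - _]mul1mx; apply/eqP/sub_kermxP.
  apply: (submx_trans full); rewrite [X in (X <= _)%MS]big_seq; apply: addsmx_seq_sub => i si.
  apply/sub_kermxP; rewrite mulmxBr mulmx1 mulmx_sumr (bigD1_seq i si us) /= /P si.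
  rewrite proj_mx_id ?cap0// big1 ?addr0 ?subrr// => j ji.
  case: ifP => sj; last by rewrite mulmx0.
  by rewrite proj_mx_0 ?cap0// /V (addsmx_seq_sup _ _ _ _ i)// eq_sym.
Qed.

End DirectSums.

Lemma mem_zrange K (k : int) : (k \in zrange K) = (`|k| <= K%:Z).
Proof.
apply/mapP/idP => [[j]|kK].
  by rewrite mem_iota => jK ->; lia.
by exists (absz (k + K%:Z)%R); rewrite ?mem_iota; lia.
Qed.

Lemma zrange_uniq K : uniq (zrange K).
Proof. by rewrite map_inj_uniq ?iota_uniq// => i j; lia. Qed.

(** * The Deligne bigrading expressed through its projectors *)

Section Projectors.
Context {R : realType} {n : nat}.
Local Notation mx := 'M[R[i]]_n.
Implicit Types (I Pi : int -> int -> mx) (p q a b k : int).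

(** Right multiplication by [Pi p q] projects row vectors onto [I p q] along the other summands. The
    list [s] makes the resolution of the identity a finite sum over bidegrees. *)
Definition projectors I Pi : Prop :=
  [/\ forall p q, (Pi p q <= I p q)%MS,
      forall p q, I p q *m Pi p q = I p q,
      forall p q a b, (a, b) != (p, q) -> I p q *m Pi a b = 0 &
      exists s : seq (int * int), \sum_(x <- s) Pi x.1 x.2 = 1%:M].

Lemma deligne_projectors (F W : int -> mx) I :
  deligne_bigrading F W I -> exists Pi, projectors I Pi.
Proof.
move=> [K [I0 [full [rk _]]]].
pose s := [seq (p, q) | p <- zrange K, q <- zrange K].
have ms p q : ((p, q) \in s) = (`|p| <= K%:Z) && (`|q| <= K%:Z).
  rewrite -!mem_zrange; apply/allpairsP/andP => [[[a b] [/= aK bK [-> ->]]]//|[pK qK]].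
  by exists (p, q).
have [||| P [P1 P2 P3 P4]] := @direct_sum_projectors _ n _ s (fun x => I x.1 x.2).
- by rewrite allpairs_uniq ?zrange_uniq// => -[? ?] [].
- by rewrite big_allpairs (eqmxP full).
- by rewrite !big_allpairs.
exists (fun p q => P (p, q)).
(* Outside the box the summands are zero, so the clauses hold for all integers and not only for
   those in [s]. *)
have I00 p q : (p, q) \notin s -> I p q = 0.
  rewrite ms => H; apply/eqP; rewrite -submx0; apply: I0.
  by move: H; rewrite negb_and -!ltNge.
split.
- by move=> p q; exact: P1 (p, q).
- move=> p q; have [/P2//|/I00->] := boolP ((p, q) \in s); exact: mul0mx.
- move=> p q a b ne; have [/P3|/I00->] := boolP ((p, q) \in s); last by rewrite mul0mx.
  by apply.
- by exists s; rewrite -P4; apply: eq_bigr => -[].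
Qed.

Section Theory.
Context {I Pi : int -> int -> mx} (HP : projectors I Pi).

Lemma proj_sub p q : (Pi p q <= I p q)%MS. Proof. by case: HP. Qed.

Lemma proj_id {p q m} {M : 'M[R[i]]_(m, n)} : (M <= I p q)%MS -> M *m Pi p q = M.
Proof. by case: HP => _ Id _ _ /submxP[D ->]; rewrite -mulmxA Id. Qed.

Lemma proj_ne {p q a b m} {M : 'M[R[i]]_(m, n)} :
  (M <= I p q)%MS -> (a, b) != (p, q) -> M *m Pi a b = 0.
Proof. by case: HP => _ _ Ne _ /submxP[D ->] /Ne H; rewrite -mulmxA H mulmx0. Qed.

Lemma proj_sup {m m'} {M : 'M[R[i]]_(m, n)} {A : 'M[R[i]]_(m', n)} :
  (forall a b, (M *m Pi a b <= A)%MS) -> (M <= A)%MS.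
Proof.
case: HP => _ _ _ [s s1] H; rewrite -[M]mulmx1 -s1 mulmx_sumr.
by apply: summx_sub => x _.
Qed.

Lemma proj_eqr {m} {X Y : 'M[R[i]]_(m, n)} :
  (forall a b, X *m Pi a b = Y *m Pi a b) -> X = Y.
Proof.
case: HP => _ _ _ [s s1] H; rewrite -[X]mulmx1 -[Y]mulmx1 -s1 !mulmx_sumr.
by apply: eq_bigr.
Qed.

Lemma proj_eql {m} {X Y : 'M[R[i]]_(n, m)} :
  (forall a b, Pi a b *m X = Pi a b *m Y) -> X = Y.
Proof.
case: HP => _ _ _ [s s1] H; rewrite -[X]mul1mx -[Y]mul1mx -s1 !mulmx_suml.
by apply: eq_bigr.
Qed.

Lemma proj_piece {p q m} {M : 'M[R[i]]_(m, n)} :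
  (forall a b, (a, b) != (p, q) -> M *m Pi a b = 0) -> (M <= I p q)%MS.
Proof.
move=> H; apply: proj_sup => a b.
have [[-> ->]|/H->] := eqVneq (a, b) (p, q); last exact: sub0mx.
exact: submx_trans (submxMl _ _) (proj_sub _ _).
Qed.

End Theory.

(** The bigrading axioms as inclusions of summands and vanishing of components, the form in which
    bidegrees are computed. [dp_conj] is one inclusion of the congruence: conj I^{p,q} has
    components only in bidegree (q,p) and in those strictly below it in both indices. *)
Record deligne_proj (F W : int -> mx) I Pi : Prop := DeligneProj {
  dp_proj :> projectors I Pi;
  dp_F : forall p a b, p <= a -> (I a b <= F p)%MS;
  dp_F0 : forall p a b, a < p -> F p *m Pi a b = 0;
  dp_W : forall k a b, a + b <= k -> (I a b <= W k)%MS;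
  dp_W0 : forall k a b, k < a + b -> W k *m Pi a b = 0;
  dp_conj : forall p q a b, (a, b) != (q, p) -> ~~ ((a < q) && (b < p)) ->
    conjm (I p q) *m Pi a b = 0 }.

Lemma deligne_projP (F W : int -> mx) I :
  deligne_bigrading F W I -> exists Pi, deligne_proj F W I Pi.
Proof.
move=> HI; have [Pi HP] := deligne_projectors _ _ _ HI.
have [K [I0 [_ [_ [HF [HW HC]]]]]] := HI.
(* No bound on [(a, b)] is required, because [I a b] is zero outside the range of summation. *)
have sup m (M : 'M[R[i]]_(m, n)) a b (P Q : int -> int -> bool) :
    P a b -> Q a b -> (M <= I a b)%MS ->
    (M <= \sum_(a <- zrange K | P a b) \sum_(b <- zrange K | Q a b) I a b)%MS.
  move=> Pab Qab Mab.
  have [out|/norP[]] := boolP ((K%:Z < `|a|)%R || (K%:Z < `|b|)%R).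
    by rewrite (submx_trans Mab)// (submx_trans (I0 _ _ out))// sub0mx.
  rewrite -!leNgt -!mem_zrange => aK bK.
  by apply: (addsmx_seq_sup _ _ _ _ a) => //; apply: (addsmx_seq_sup _ _ _ _ b).
have sub0 (P Q : int -> int -> bool) b' m (M : 'M[R[i]]_(n, m)) :
    (forall a b, P a b' -> Q a b -> I a b *m M = 0) ->
    (\sum_(a <- zrange K | P a b') \sum_(b <- zrange K | Q a b) I a b)%MS *m M = 0.
  move=> H; apply/sub_kermxP; apply: addsmx_seq_sub => a Pa.
  by apply: addsmx_seq_sub => b Qb; apply/sub_kermxP; exact: H.
have eqmul0 m (A B : mx) (M : 'M[R[i]]_(n, m)) : (A <= B)%MS -> B *m M = 0 -> A *m M = 0.
  by move=> /submxP[D ->] BM; rewrite -mulmxA BM mulmx0.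
exists Pi; split => //.
- move=> p a b pa; rewrite (eqmxP (HF p)).
  by apply: (sup _ _ a b (fun a _ => p <= a) (fun _ _ => true)).
- move=> p a b ap; apply: eqmul0; first by case/andP: (HF p) => + _; apply.
  apply: (sub0 (fun a _ => p <= a) (fun _ _ => true) b) => c d pc _.
  apply: (proj_ne HP (submx_refl _)); apply/eqP => -[]; lia.
- move=> k a b abk; rewrite (eqmxP (HW k)).
  by apply: (sup _ _ a b (fun _ _ => true) (fun a b => a + b <= k)).
- move=> k a b abk; apply: eqmul0; first by case/andP: (HW k) => + _; apply.
  apply: (sub0 (fun _ _ => true) (fun a b => a + b <= k) b) => c d _ cd.
  apply: (proj_ne HP (submx_refl _)); apply/eqP => -[]; lia.
- move=> p q a b ne lt; apply: eqmul0.
    by case/andP: (HC p q) => + _; apply: submx_trans; rewrite addsmxSl.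
  apply/sub_kermxP; rewrite addsmx_sub; apply/andP; split; apply/sub_kermxP.
    exact: (proj_ne HP (submx_refl _)).
  apply: (sub0 (fun r _ => r < q) (fun _ s => s < p) b) => c d cq dp.
  apply: (proj_ne HP (submx_refl _)); apply/eqP => -[]; lia.
Qed.

End Projectors.

(** * Complex conjugation of matrices and actions on subspaces *)

Section Conjugation.
Context {R : realType}.

Lemma conjmK {m n} (A : 'M[R[i]]_(m, n)) : conjm (conjm A) = A.
Proof. by apply/matrixP => i j; rewrite !mxE conjcK. Qed.

Lemma conjmM {m n p} (A : 'M[R[i]]_(m, n)) (B : 'M[R[i]]_(n, p)) :
  conjm (A *m B) = conjm A *m conjm B.
Proof. exact: map_mxM. Qed.

Lemma conjmB {m n} (A B : 'M[R[i]]_(m, n)) : conjm (A - B) = conjm A - conjm B.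
Proof. exact: map_mxB. Qed.

Lemma conjmZ {m n} c (A : 'M[R[i]]_(m, n)) : conjm (c *: A) = conjc c *: conjm A.
Proof. exact: map_mxZ. Qed.

Lemma conjm_inv {n} (A : 'M[R[i]]_n) : conjm (invmx A) = invmx (conjm A).
Proof. exact: map_invmx. Qed.

Lemma conjm_sub {m1 m2 n} (A : 'M[R[i]]_(m1, n)) (B : 'M[R[i]]_(m2, n)) :
  (A <= B)%MS -> (conjm A <= conjm B)%MS.
Proof. by rewrite map_submx. Qed.

Lemma conjm_eq0 {m n} (A : 'M[R[i]]_(m, n)) : conjm A = 0 -> A = 0.
Proof. by move=> A0; rewrite -[A]conjmK A0 /conjm map_mx0. Qed.

End Conjugation.

Lemma mulmx_sub0 {F : fieldType} {m1 m2 n p} {A : 'M[F]_(m1, n)} {B : 'M[F]_(m2, n)}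
  {Z : 'M[F]_(n, p)} : (A <= B)%MS -> B *m Z = 0 -> A *m Z = 0.
Proof. by move=> /submxP[D ->] BZ; rewrite -mulmxA BZ mulmx0. Qed.

Lemma addsmx_mul0 {F : fieldType} {m1 m2 n p} {A : 'M[F]_(m1, n)} {B : 'M[F]_(m2, n)}
  {Z : 'M[F]_(n, p)} : A *m Z = 0 -> B *m Z = 0 -> (A + B)%MS *m Z = 0.
Proof.
by move=> AZ BZ; apply/sub_kermxP; rewrite addsmx_sub; apply/andP; split;
  apply/sub_kermxP.
Qed.

Section Actions.
Context {R : realType} {n : nat}.
Local Notation mx := 'M[R[i]]_n.
Implicit Types (X Y h : mx) (W : int -> mx).

Lemma act_sub {m} {M : 'M[R[i]]_(m, n)} {A B X : mx} :
  (act X A <= B)%MS -> (M <= A)%MS -> (M *m X^T <= B)%MS.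
Proof. by move=> XA MA; apply: submx_trans XA; rewrite /act submxMr. Qed.

(** An invertible [h] maps [W k] into itself with the same rank, hence onto itself. *)
Lemma preservesW_inv W h : h \in unitmx -> preservesW W h -> preservesW W (invmx h).
Proof.
move=> hu hW k; have htu : h^T \in unitmx by rewrite unitmx_tr.
have : (W k <= act h (W k))%MS.
  by rewrite -(geq_leqif (mxrank_leqif_sup (hW k))) /act mxrankMfree// row_free_unit.
by move=> /(submxMr (invmx h)^T); rewrite /act trmx_inv mulmxK.
Qed.

Lemma preservesWM W X Y : preservesW W X -> preservesW W Y -> preservesW W (X *m Y).
Proof.
by move=> WX WY k; rewrite /act trmx_mul mulmxA; apply: act_sub (WX k) (WY k).
Qed.

End Actions.

(** * Endomorphisms classified by their bidegrees *)

Section Types.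
Context {R : realType} {n : nat}.
Local Notation mx := 'M[R[i]]_n.
Context {I Pi : int -> int -> mx} (HP : projectors I Pi).
Implicit Types (P : int -> int -> bool) (X Y : mx).

(* [X] is a sum of endomorphisms of bidegrees [(r, s)] satisfying [P]. *)
Definition of_type P X : Prop :=
  forall p q a b, ~~ P (a - p) (b - q) -> Pi p q *m X^T *m Pi a b = 0.

(** Inserting the identity, as a sum of projectors, between the two factors splits the product by
    intermediate bidegree [(c, d)]. The transpose makes [Y] act first. *)
Lemma of_typeM P1 P2 P X Y :
  (forall r s r' s', P1 r s -> P2 r' s' -> P (r + r') (s + s')) ->
  of_type P1 X -> of_type P2 Y -> of_type P (X *m Y).
Proof.
move=> PP X1 Y2 p q a b nP; rewrite trmx_mul mulmxA -(mulmxA (_ *m _)).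
have [_ _ _ [s s1]] := HP.
rewrite -[Pi p q *m Y^T]mulmx1 -s1 mulmx_sumr mulmx_suml; apply: big1 => -[c d] _ /=.
have [P2Y|/Y2->] := boolP (P2 (c - p) (d - q)); last by rewrite mul0mx.
have [P1X|/X1 X0] := boolP (P1 (a - c) (b - d)).
  by case/negP: nP; move: (PP _ _ _ _ P1X P2Y); rewrite !subrKA.
by rewrite -mulmxA [Pi c d *m _]mulmxA X0 mulmx0.
Qed.

Lemma of_typeD P X Y : of_type P X -> of_type P Y -> of_type P (X + Y).
Proof.
move=> TX TY p q a b nP.
by rewrite linearD mulmxDr mulmxDl TX ?TY ?addr0.
Qed.

Lemma of_typeZ P c X : of_type P X -> of_type P (c *: X).
Proof.
by move=> TX p q a b nP; rewrite linearZ -scalemxAr -scalemxAl TX ?scaler0.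
Qed.

Lemma of_typeN P X : of_type P X -> of_type P (- X).
Proof. by rewrite -scaleN1r; exact: of_typeZ. Qed.

Lemma of_type_sub P1 P2 X : (forall r s, P1 r s -> P2 r s) ->
  of_type P1 X -> of_type P2 X.
Proof. by move=> PP TX p q a b nP; apply: TX; apply: contra nP; exact: PP. Qed.

Lemma of_typeI P1 P2 X : of_type P1 X -> of_type P2 X ->
  of_type (fun r s => P1 r s && P2 r s) X.
Proof. by move=> T1 T2 p q a b; rewrite negb_and => /orP[/T1|/T2]. Qed.

Lemma of_type0P X p q : of_type (fun r s => (r == 0) && (s == 0)) X ->
  (act X (I p q) <= I p q)%MS.
Proof.
move=> TX; apply: (proj_piece HP) => a b ne.
rewrite /act -[I p q](proj_id HP (submx_refl _)) -!mulmxA [X in I p q *m X]mulmxA TX ?mulmx0//.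
by rewrite !subr_eq0 -pair_eqE /= in ne *.
Qed.

Hypothesis split : split_over_R I.

(** Conjugation permutes the summands of a split bigrading, so it permutes the projections onto them
    in the same way. *)
Lemma conjm_proj p q : conjm (Pi p q) = Pi q p.
Proof.
apply: (proj_eql HP) => a b.
have sub : (conjm (Pi a b) <= I b a)%MS.
  by rewrite -(eqmxP (split a b)) conjm_sub// (proj_sub HP).
rewrite -[Pi a b]conjmK -conjmM.
have [[-> ->]|ne] := eqVneq (p, q) (b, a).
  by rewrite (proj_id HP sub) conjmK (proj_id HP (proj_sub HP _ _)).
rewrite (proj_ne HP sub ne) conjmK (proj_ne HP (proj_sub HP _ _)) ?/conjm ?map_mx0//.
by apply: contra ne => /eqP[-> ->].
Qed.

Lemma of_type_conj P X : of_type P X -> of_type (fun r s => P s r) (conjm X).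
Proof.
move=> TX p q a b nP.
apply: conjm_eq0; rewrite !conjmM !conjm_proj /conjm map_trmx -/(conjm _).
by rewrite conjmK TX.
Qed.

End Types.
Arguments of_type {R n} Pi P X.

Section DeligneTypes.
Context {R : realType} {n : nat}.
Local Notation mx := 'M[R[i]]_n.
Context {F W : int -> mx} {I Pi : int -> int -> mx} (HD : deligne_proj F W I Pi).

Lemma preservesW_type X : preservesW W X -> of_type Pi (fun r s => r + s <= 0) X.
Proof.
move=> WX p q a b; rewrite -ltNge => lt0.
have PW : (Pi p q <= W (p + q))%MS.
  exact: submx_trans (proj_sub HD _ _) (dp_W _ _ _ _ HD _ _ _ (lexx _)).
by apply: mulmx_sub0 (act_sub (WX _) PW) (dp_W0 _ _ _ _ HD _ _ _ _); lia.
Qed.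

Lemma preservesF_type X : (forall p, (act X (F p) <= F p)%MS) ->
  of_type Pi (fun r s => 0 <= r) X.
Proof.
move=> FX p q a b; rewrite -ltNge => lt0.
have PF : (Pi p q <= F p)%MS.
  exact: submx_trans (proj_sub HD _ _) (dp_F _ _ _ _ HD _ _ _ (lexx _)).
by apply: mulmx_sub0 (act_sub (FX _) PF) (dp_F0 _ _ _ _ HD _ _ _ _); lia.
Qed.

(** By splitness, the condition [a + b <= k] on the summands of [W k] is symmetric under
    conjugation. *)
Lemma conjm_W k : split_over_R I -> (conjm (W k) <= W k)%MS.
Proof.
move=> sp; apply: (proj_sup HD) => a b.
have [le|lt] := leP (a + b) k.
  apply: submx_trans (dp_W _ _ _ _ HD _ _ _ le).
  exact: submx_trans (submxMl _ _) (proj_sub HD _ _).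
rewrite -(conjm_proj HD sp) -conjmM (dp_W0 _ _ _ _ HD) ?/conjm ?map_mx0 ?sub0mx//.
by rewrite addrC.
Qed.

Lemma grading_Y_proj Y a b : grading_Y I Y ->
  Y^T *m Pi a b = (a + b)%:~R *: Pi a b.
Proof.
move=> HY.
have IY p q m (M : 'M[R[i]]_(m, n)) : (M <= I p q)%MS -> M *m Y^T = (p + q)%:~R *: M.
  move=> MI; apply/row_matrixP => i; rewrite row_mul linearZ /=.
  by apply: HY; rewrite (submx_trans _ MI)// row_sub.
apply: (proj_eql HD) => c d.
rewrite mulmxA (IY c d) ?(proj_sub HD)// -scalemxAl -scalemxAr.
have [[-> ->]//|ne] := eqVneq (a, b) (c, d).
by rewrite (proj_ne HD (proj_sub HD _ _) ne) !scaler0.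
Qed.

End DeligneTypes.

(** * Transport of the Deligne bigrading by [h] *)

Section Transport.
Context {R : realType} {n : nat}.
Local Notation mx := 'M[R[i]]_n.
Context {Fo Ft W : int -> mx} {I Pi J PJ : int -> int -> mx}.
Context (HI : deligne_proj Fo W I Pi) (HJ : deligne_proj Ft W J PJ).
Context (sp : split_over_R I) {Y h : mx}.
Context (hu : h \in unitmx) (hW : preservesW W h) (hR : real_mod W 1 h).
Context (YI : grading_Y I Y) (YJ : grading_Y J (h *m Y *m invmx h)).
Context (hF : forall k p : int,
  (act h (Fo p :&: W k + W (k - 1)%R)%MS == Ft p :&: W k + W (k - 1)%R)%MS).

Let htu : h^T \in unitmx. Proof. by rewrite unitmx_tr. Qed.

Lemma sub_FW k p q m (M : 'M[R[i]]_(m, n)) : p + q = k -> (M <= I p q)%MS ->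
  (M *m h^T <= Ft p :&: W k + W (k - 1)%R)%MS.
Proof.
move=> pqk MI; have /andP[+ _] := hF k p; move/act_sub; apply.
apply: submx_trans (addsmxSl _ _); rewrite sub_capmx !(submx_trans MI)//.
  by rewrite (dp_W _ _ _ _ HI)// pqk.
by rewrite (dp_F _ _ _ _ HI).
Qed.

Lemma W_proj0 k a b m (M : 'M[R[i]]_(m, n)) : (M <= W k)%MS -> k < a + b ->
  M *m PJ a b = 0.
Proof. by move=> MW lt; apply: mulmx_sub0 MW (dp_W0 _ _ _ _ HJ _ _ _ lt). Qed.

(** Each component in another [J a b] is excluded: by the gradings if the weight differs, by the
    Hodge filtration if [a < p], and by the conjugate filtration if [b < q]. *)
Lemma transport_sub p q : (I p q *m h^T <= J p q)%MS.
Proof.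
apply: (proj_piece HJ) => a b ne; set w := _ *m h^T.
have [abk|abk] := eqVneq (a + b) (p + q); last first.
  (* [h] intertwines [Y] with [h Y h^-1], so this component is an eigenvector for both weights. *)
  have H : (p + q)%:~R *: (w *m PJ a b) = (a + b)%:~R *: (w *m PJ a b).
    rewrite [RHS]scalemxAr -(grading_Y_proj HJ _ _ _ YJ) mulmxA scalemxAl.
    congr (_ *m _); rewrite /w !trmx_mul trmx_inv !mulmxA mulmxK//.
    rewrite scalemxAl; congr (_ *m _); apply: (proj_eqr HI) => c d.
    rewrite -mulmxA (grading_Y_proj HI _ _ _ YI) -scalemxAr -scalemxAl.
    have [[-> ->]//|cd] := eqVneq (c, d) (p, q).
    by rewrite (proj_ne HI (submx_refl _) cd) !scaler0.
  apply/eqP; move/eqP: H; rewrite -subr_eq0 -scalerBl scaler_eq0 => /orP[|//].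
  by rewrite -intrB intr_eq0 subr_eq0 eq_sym (negPf abk).
have [ap|pa] := ltP a p.
  apply: mulmx_sub0 (sub_FW _ _ q _ _ erefl (submx_refl _)) _.
  apply: addsmx_mul0; last by apply: W_proj0 (submx_refl _) _; lia.
  exact: mulmx_sub0 (capmxSl _ _) (dp_F0 _ _ _ _ HJ _ _ _ ap).
have bq : b < q.
  rewrite ltNge; apply/negP => qb; case/negP: ne.
  by apply/eqP; congr pair; lia.
(* Since [Gr(h)] is real, [h] may be replaced by its conjugate modulo [W (p + q - 1)], which has no
   component of weight [a + b]. After conjugation the source becomes [I q p], to which the
   filtration argument applies. *)
have -> : w = I p q *m (conjm h)^T + I p q *m (h - conjm h)^T.
  by rewrite -mulmxDr -linearD /= addrC subrK.
rewrite mulmxDl.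
rewrite [X in _ + X](W_proj0 (p + q - 1)); last 2 first.
- exact: act_sub (hR _) (dp_W _ _ _ _ HI _ _ _ (lexx _)).
- by lia.
rewrite addr0.
apply: conjm_eq0; rewrite !conjmM /conjm map_trmx -!/(conjm _) conjmK.
have sub : (conjm (I p q) <= I q p)%MS by rewrite (eqmxP (sp p q)).
apply: mulmx_sub0 (sub_FW _ _ _ _ _ erefl sub) _.
apply: addsmx_mul0; last first.
  apply: conjm_eq0; rewrite conjmM conjmK.
  by apply: W_proj0 (conjm_W HI _ sp) _; lia.
(* A nonzero component of [Ft q :&: W (q + p)] in [J c d] has [q <= c] and [c + d <= q + p], hence
   [d <= p <= a] and [b < q <= c]. So [(a, b)] is neither [(d, c)] nor strictly below it in both
   indices. *)
apply/sub_kermxP; apply: (proj_sup HJ) => c d; apply/sub_kermxP.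
have [cq|qc] := ltP c q.
  by rewrite (mulmx_sub0 (capmxSl _ _) (dp_F0 _ _ _ _ HJ _ _ _ cq)) mul0mx.
have [cd|cd] := ltP (q + p) (c + d).
  by rewrite (mulmx_sub0 (capmxSr _ _) (dp_W0 _ _ _ _ HJ _ _ _ cd)) mul0mx.
rewrite -mulmxA.
suff -> : PJ c d *m conjm (PJ a b) = 0 by rewrite mulmx0.
apply: conjm_eq0; rewrite conjmM conjmK.
apply: mulmx_sub0 (conjm_sub _ _ (proj_sub HJ c d)) (dp_conj _ _ _ _ HJ _ _ _ _ _ _).
  by apply/eqP => -[]; lia.
by apply/negP => /andP[]; lia.
Qed.

Lemma proj_transport a b : Pi a b *m h^T = h^T *m PJ a b.
Proof.
apply: (proj_eql HI) => c d.
have PcJ : (Pi c d *m h^T <= J c d)%MS.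
  by apply: submx_trans (transport_sub c d); rewrite submxMr// (proj_sub HI).
rewrite !mulmxA; have [[-> ->]|ne] := eqVneq (a, b) (c, d).
  by rewrite (proj_id HI (proj_sub HI _ _)) (proj_id HJ PcJ).
by rewrite (proj_ne HI (proj_sub HI _ _) ne) (proj_ne HJ PcJ ne) mul0mx.
Qed.

(** The hypothesis [hF] controls the filtrations only on the graded quotients; compatibility with
    the bigradings lifts this to the filtrations themselves. *)
Lemma transport_F p : (Fo p *m h^T <= Ft p)%MS.
Proof.
apply: (proj_sup HJ) => a b; have [ap|pa] := ltP a p.
  by rewrite -mulmxA -proj_transport mulmxA (dp_F0 _ _ _ _ HI _ _ _ ap) mul0mx sub0mx.
apply: submx_trans (dp_F _ _ _ _ HJ _ _ _ pa).
exact: submx_trans (submxMl _ _) (proj_sub HJ _ _).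
Qed.

Lemma proj_transport_inv a b : invmx h^T *m Pi a b = PJ a b *m invmx h^T.
Proof. by rewrite -[Pi a b](mulmxK htu) proj_transport -mulmxA mulKmx. Qed.

Lemma transport_F_inv p : (Ft p *m invmx h^T <= Fo p)%MS.
Proof.
apply: (proj_sup HI) => a b; have [ap|pa] := ltP a p.
  by rewrite -mulmxA proj_transport_inv mulmxA (dp_F0 _ _ _ _ HJ _ _ _ ap) mul0mx sub0mx.
apply: submx_trans (dp_F _ _ _ _ HI _ _ _ pa).
exact: submx_trans (submxMl _ _) (proj_sub HI _ _).
Qed.

Lemma conj_defect_type :
  of_type Pi (fun r s => (r < 0) && (s < 0)) (invmx h *m conjm h - 1%:M).
Proof.
move=> p q a b nlt.
(* In bidegree (0,0) the component vanishes because [h - conjm h] lowers weights, [Gr(h)] being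
   real. *)
have [[-> ->]|ne] := eqVneq (a, b) (p, q).
  have -> : invmx h *m conjm h - 1%:M = - (invmx h *m (h - conjm h)).
    by rewrite mulmxBr mulVmx// opprB.
  rewrite linearN /= mulmxN mulNmx trmx_mul mulmxA.
  rewrite (mulmx_sub0 (_ : (_ <= W (p + q - 1))%MS) (dp_W0 _ _ _ _ HI _ _ _ _)) ?oppr0//.
    apply: act_sub (preservesW_inv _ _ hu hW _) _.
    apply: act_sub (hR _) _.
    exact: submx_trans (proj_sub HI _ _) (dp_W _ _ _ _ HI _ _ _ (lexx _)).
  by lia.
rewrite linearB /= trmx1 mulmxBr mulmxBl mulmx1 (proj_ne HI (proj_sub HI _ _) ne) subr0.
rewrite trmx_mul trmx_inv mulmxA -[_ *m invmx _ *m _]mulmxA proj_transport_inv mulmxA.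
(* By splitness the conjugate of [h] sends I^{p,q} into the conjugate of J^{q,p}, whose components
   are confined by [dp_conj]. *)
have -> : Pi p q *m (conjm h)^T = conjm (Pi q p *m h^T).
  by rewrite conjmM (conjm_proj HI sp) /conjm map_trmx.
have sub : (Pi q p *m h^T <= J q p)%MS.
  by apply: submx_trans (transport_sub q p); rewrite submxMr// (proj_sub HI).
rewrite (mulmx_sub0 (conjm_sub _ _ sub) (dp_conj _ _ _ _ HJ _ _ _ _ _ _)) ?mul0mx//.
by move: nlt; rewrite !subr_lt0.
Qed.

End Transport.

Lemma near_gt {R : realType} (a y : R) (P : R -> Prop) :
  a < y -> (forall t, a < t -> P t) -> \near y, P y.
Proof.
by move=> ay H; apply: filterS (lt_nbhsr ay) => t /= /H.
Qed.

(** * Linear structure of g_C and its stability under Ad *)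

Section LieAlgebra.
Context {R : realType} {n : nat}.
Local Notation mx := 'M[R[i]]_n.
Context {W S : int -> mx}.
Implicit Types X Y g : mx.

Lemma bilDl (T : mx) u u' v : bil T (u + u') v = bil T u v + bil T u' v.
Proof. by rewrite /bil !mulmxDl mxE. Qed.

Lemma bilDr (T : mx) u v v' : bil T u (v + v') = bil T u v + bil T u v'.
Proof. by rewrite /bil linearD mulmxDr mxE. Qed.

Lemma bilZl (T : mx) c u v : bil T (c *: u) v = c * bil T u v.
Proof. by rewrite /bil -!scalemxAl mxE. Qed.

Lemma bilZr (T : mx) c u v : bil T u (c *: v) = c * bil T u v.
Proof. by rewrite /bil linearZ /= -scalemxAr mxE. Qed.

Lemma in_gCZD c X Y : in_gC W S X -> in_gC W S Y -> in_gC W S (c *: X + Y).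
Proof.
move=> [WX SX] [WY SY]; split.
  move=> k; rewrite /act linearD linearZ mulmxDr /= -scalemxAr.
  by rewrite addmx_sub ?scalemx_sub ?WX ?WY.
move=> k u v uW vW; rewrite linearD linearZ !mulmxDr /= -!scalemxAr.
rewrite bilDl bilDr bilZl bilZr addrACA -mulrDr SX// SY//.
by rewrite mulr0 addr0.
Qed.

Lemma in_gC0 : in_gC W S 0.
Proof.
split=> [k|k u v _ _]; first by rewrite /act trmx0 mulmx0 sub0mx.
by rewrite trmx0 !mulmx0 /bil !mul0mx trmx0 mulmx0 mxE addr0.
Qed.

Lemma in_gCZ c X : in_gC W S X -> in_gC W S (c *: X).
Proof. by move=> X1; rewrite -[_ *: _]addr0; apply: in_gCZD X1 in_gC0. Qed.

Lemma in_gCD X Y : in_gC W S X -> in_gC W S Y -> in_gC W S (X + Y).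
Proof. by move=> X1; rewrite -[X]scale1r; exact: in_gCZD. Qed.

Lemma in_gC_sum (T : Type) (r : seq T) (D : T -> mx) :
  (forall i, in_gC W S (D i)) -> in_gC W S (\sum_(i <- r) D i).
Proof.
by move=> HD; elim/big_ind: _ => // [|X Y]; [exact: in_gC0 | exact: in_gCD].
Qed.

Lemma in_gC_Ad g X : inG_C W S g -> in_gC W S X -> in_gC W S (invmx g *m X *m g).
Proof.
move=> [gu [gW gS]] [WX SX]; have giW := preservesW_inv _ _ gu gW.
have gtu : g^T \in unitmx by rewrite unitmx_tr.
split; first by apply: preservesWM gW; apply: preservesWM giW WX.
move=> k u v uW vW.
have uGW := act_sub (gW k) uW; have vGW := act_sub (gW k) vW.
(* As [g] is an isometry on [W k], an inverse of [g] on one argument of the form becomes [g] on the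
   other. *)
have inv_bil x z : (x <= W k)%MS -> (z <= W k)%MS ->
    bil (S k) (x *m (invmx g)^T) z = bil (S k) x (z *m g^T) /\
    bil (S k) z (x *m (invmx g)^T) = bil (S k) (z *m g^T) x.
  move=> xW zW; have xG := act_sub (giW k) xW.
  by rewrite -[in LHS](gS k) // -[in X in _ /\ X](gS k) // trmx_inv mulmxKV.
have [e1 _] := inv_bil _ _ (act_sub (WX k) uGW) vW.
have [_ e2] := inv_bil _ _ (act_sub (WX k) vGW) uW.
by rewrite !trmx_mul !mulmxA e1 e2 SX.
Qed.

End LieAlgebra.

(** * Bidegree components of derivatives and of decompositions *)

Section Components.
Context {R : realType} {n : nat}.
Local Notation mx := 'M[R[i]]_n.
Context {W S : int -> mx} {I Pi : int -> int -> mx} (HP : projectors I Pi).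

Lemma of_type_deriv P (u : R -> mx) (y : R) D :
  has_deriv u y D -> (\near y, of_type Pi P (u y)) -> of_type Pi P D.
Proof.
move=> du uP p q a b nP.
have := has_derivM (has_derivM (has_deriv_cst (Pi p q) y) (has_deriv_tr du))
                   (has_deriv_cst (Pi a b) y).
rewrite mul0mx add0r mulmx0 addr0; apply: has_deriv_vanish.
by apply: filterS uP => t /= ->.
Qed.

(** Each [D r s] shifts bidegrees by [(r, s)], so between [Pi p q] and [Pi a b] only the term with
    shift [(a - p, b - q)] survives, in the weighted sum as in [X]. *)
Lemma rs_component X K D (c : int -> int -> R[i]) p q a b :
  rs_decomposition W S I X K D ->
  Pi p q *m (\sum_(r <- zrange K) \sum_(s <- zrange K) c r s *: D r s)^T *m Pi a b
  = c (a - p) (b - q) *: (Pi p q *m X^T *m Pi a b).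
Proof.
move=> [_ [Drs ->]].
have compE (F : int -> int -> mx) :
    Pi p q *m (\sum_(r <- zrange K) \sum_(s <- zrange K) F r s)^T *m Pi a b =
    \sum_(r <- zrange K) \sum_(s <- zrange K) Pi p q *m (F r s)^T *m Pi a b.
  rewrite linear_sum /= mulmx_sumr mulmx_suml; apply: eq_bigr => r _.
  by rewrite linear_sum /= mulmx_sumr mulmx_suml.
rewrite !compE scaler_sumr; apply: eq_bigr => r _.
rewrite scaler_sumr; apply: eq_bigr => s _; rewrite linearZ /= -scalemxAr -scalemxAl.
have [[-> ->]//|ne] := eqVneq (r, s) (a - p, b - q).
suff -> : Pi p q *m (D r s)^T *m Pi a b = 0 by rewrite !scaler0.
have [_ Irs] := Drs r s.
apply: (proj_ne HP (act_sub (Irs p q) (proj_sub HP p q))).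
by apply: contra ne => /eqP[-> ->]; apply/eqP; congr pair; ring.
Qed.

End Components.

(** * The differential equation satisfied by [h] *)

Theorem theorem6p11 (R : realType) (n : nat)
  (W : int -> 'M[R[i]]_n) (S : int -> 'M[R[i]]_n) (fdim : int -> nat)
  (HW : rational_weight_filtration W) (HS : graded_forms W S)
  (N : 'M[R[i]]_n) (Finf : int -> 'M[R[i]]_n)
  (Hadm : admissible_orbit W S fdim N Finf)
  (a : R)
  (Htheta : forall y : R, a < y -> in_M W S fdim (theta N Finf (Complex 0 y)))
  (Fo : int -> 'M[R[i]]_n) (HFo : in_M W S fdim Fo)
  (Io : int -> int -> 'M[R[i]]_n) (HIo : deligne_bigrading Fo W Io)
  (Hsplit : split_over_R Io)
  (Yo : 'M[R[i]]_n) (HYo : grading_Y Io Yo)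
  (h h' : R -> 'M[R[i]]_n)
  (HhH : forall y, a < y -> inH W S (h y))
  (Hder : forall y, a < y -> has_deriv h y (h' y))
  (Ha1 : forall y, a < y -> forall k p : int,
     (act (h y) (Fo p :&: W k + W (k - 1)%R)%MS ==
        theta N Finf (Complex 0 y) p :&: W k + W (k - 1)%R)%MS)
  (Ha2 : forall y, a < y ->
     is_Y (theta N Finf (Complex 0 y)) W (h y *m Yo *m invmx (h y)))
  (Hb : forall y, a < y ->
     in_h W S (invmx (h y) *m h' y) /\ in_eta_sum W S Io (invmx (h y) *m h' y)) :
  forall y, a < y ->
    L_image W S Io (invmx (h y) *m N *m h y) (- (invmx (h y) *m h' y)).
Proof.
move=> y ay.
have [_ [[[NgC _] Nreal] [[m Nm] _]]] := Hadm.
have N0 : N ^+ n.+1 = 0 by rewrite exprSr (nilpotent_mx_expn _ _ _ _ Nm) mul0r.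
pose E t := mexp (Complex 0 t *: N).
(* For very negative [p] the filtration theta(it) is the whole space, and it is contained in the row
   space of the transpose of [E t]. *)
have Eu t : a < t -> E t \in unitmx.
  move=> /Htheta[[_ [P HP]] _]; rewrite -unitmx_tr -row_full_unit -sub1mx.
  by have [/(_ (lexx _)) + _] := HP (- P%:Z); move/submx_trans; apply; exact: submxMl.
have hu t : a < t -> h t \in unitmx by move=> /HhH[[[]]].
have [Pi HI] := deligne_projP _ _ _ HIo.
have [TF TFi Tu] : [/\ forall t, a < t -> forall p, (Fo p *m (h t)^T <= Finf p *m (E t)^T)%MS,
    forall t, a < t -> forall p, (Finf p *m (E t)^T *m invmx (h t)^T <= Fo p)%MS &
    forall t, a < t -> of_type Pi (fun r s => (r < 0) && (s < 0))
                          (invmx (h t) *m conjm (h t) - 1%:M)].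
  have aux t : a < t -> [/\ forall p, (Fo p *m (h t)^T <= Finf p *m (E t)^T)%MS,
      forall p, (Finf p *m (E t)^T *m invmx (h t)^T <= Fo p)%MS &
      of_type Pi (fun r s => (r < 0) && (s < 0)) (invmx (h t) *m conjm (h t) - 1%:M)].
    move=> at_; have [[[gu [gW _]] gR] _] := HhH t at_.
    have [J [HJ YJ]] := Ha2 t at_; have [PJ HPJ] := deligne_projP _ _ _ HJ.
    have hF := Ha1 t at_.
    split.
    + move=> p; exact: (transport_F HI HPJ Hsplit gu gR HYo YJ hF p).
    + move=> p; exact: (transport_F_inv HI HPJ Hsplit gu gR HYo YJ hF p).
    + exact: (conj_defect_type HI HPJ Hsplit gu gW gR HYo YJ hF).
  by split => t /aux[].
have uy := hu y ay; have uEy := Eu y ay.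
have uty : (h y)^T \in unitmx by rewrite unitmx_tr.
set X := invmx (h y) *m h' y; set A := invmx (h y) *m N *m h y.
have [[[XgC _] _] [K [D [HD D0]]]] := Hb y ay.
have AgC : in_gC W S A by apply: in_gC_Ad NgC; case: (HhH y ay) => -[].
have T0 : of_type Pi (fun r s => 0 <= r) (X - iC R *: A).
  apply: (preservesF_type HI) => p.
  have dE := has_deriv_inv (near_gt _ _ _ ay Eu) (has_deriv_mexp N y N0).
  have dG := has_derivM dE (Hder y ay).
  (* Multiplying by [cokermx (Finf p)] turns the inclusion of E^-1 h F_o in F_oo into an equation to
     zero, which can be differentiated. *)
  have := has_derivM (has_derivM (has_deriv_cst (Fo p) y) (has_deriv_tr dG))
                     (has_deriv_cst (cokermx (Finf p)) y).
  rewrite mul0mx add0r mulmx0 addr0 => /has_deriv_vanish H.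
  (* The derivative of E^-1 h is E^-1 (h' - iN h), because E' = iN E. *)
  have {}H : Fo p *m (invmx (E y) *m (h' y - iC R *: (N *m h y)))^T *m cokermx (Finf p) = 0.
    rewrite -[RHS]H; last first.
      apply: near_gt ay _ => t at_; apply/eqP; rewrite -submxE trmx_mul trmx_inv mulmxA.
      have Etu : (E t)^T \in unitmx by rewrite unitmx_tr Eu.
      by have := submxMr (invmx (E t)^T) (TF t at_ p); rewrite mulmxK.
    congr (_ *m _^T *m _); rewrite -/(E y) mulmxBr addrC; congr (_ + _).
    rewrite mulNmx; congr (- _); rewrite -!mulmxA; congr (_ *m _).
    by rewrite -scalemxAl -mulmxA mulKVmx.
  have {H} : (Fo p *m (invmx (E y) *m (h' y - iC R *: (N *m h y)))^T <= Finf p)%MS.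
    by rewrite submxE H.
  have Ety : (E y)^T \in unitmx by rewrite unitmx_tr.
  (* Applying [E y] and then the inverse of [h y] brings F_oo back to F_o and the operator to
     [X - iA]. *)
  move/(submxMr (E y)^T); rewrite trmx_mul trmx_inv -mulmxA mulmxKV//.
  move/(submxMr (invmx (h y)^T))/submx_trans/(_ (TFi y ay p)).
  rewrite /act -trmx_inv -mulmxA -trmx_mul mulmxBr -scalemxAr mulmxA.
  by [].
pose u := invmx (h y) *m conjm (h y).
have cu : conjm u = invmx (conjm (h y)) *m h y.
  by rewrite conjmM conjmK conjm_inv.
have ucy : conjm (h y) \in unitmx by rewrite /conjm map_unitmx.
have ucu : u *m conjm u = 1%:M by rewrite cu /u -mulmxA mulKVmx// mulVmx.
have Tdu : of_type Pi (fun r s => (r < 0) && (s < 0)) (u *m conjm X - X *m u).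
  (* The defect stays in negative bidegrees for all [t > a], so its derivative does too. *)
  apply: (@of_type_deriv _ _ _ _ (fun t => invmx (h t) *m conjm (h t) - 1%:M) y).
    have dh := Hder y ay.
    have -> : u *m conjm X - X *m u = - (X *m invmx (h y)) *m conjm (h y)
                                      + invmx (h y) *m conjm (h' y) + 0.
      have <- : u *m conjm X = invmx (h y) *m conjm (h' y).
        by rewrite /X conjmM conjm_inv /u -mulmxA mulKVmx.
      by rewrite addr0 mulNmx -[X *m _ *m _]mulmxA -/u addrC.
    exact: has_derivD (has_derivM (has_deriv_inv (near_gt _ _ _ ay hu) dh)
                                  (has_deriv_conj dh)) (has_deriv_cst (- 1%:M) y).
  exact: near_gt ay Tu.
(* The bidegrees occurring in 1 + Lambda; the condition is symmetric in [r] and [s], so it also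
   holds for the conjugate of [u]. *)
pose PU (r s : int) := ((r == 0) && (s == 0)) || ((r < 0) && (s < 0)).
have Tuy : of_type Pi PU u.
  have -> : u = (u - 1%:M) + 1%:M by rewrite subrK.
  apply: of_typeD.
    by apply: of_type_sub (Tu y ay) => r s rs; rewrite /PU rs orbT.
  move=> p q b c; rewrite /PU !subr_eq0 => /norP[ne _].
  by rewrite trmx1 mulmx1 (proj_ne HI (proj_sub HI _ _)).
have Tcu : of_type Pi PU (conjm u).
  by apply: of_type_sub (of_type_conj HI Hsplit _ _ Tuy) => r s; rewrite /PU; lia.
have TW : of_type Pi (fun r s => r + s <= 0) (X - iC R *: A).
  apply: (preservesW_type HI).
  by have [] := in_gCZD (- iC R) _ _ AgC XgC; rewrite scaleNr addrC.
have TT : of_type Pi (fun r s => (0 <= s) && (r + s <= 0)) (conjm (X - iC R *: A)).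
  apply: of_type_sub (of_type_conj HI Hsplit _ _ (of_typeI _ _ _ T0 TW)) => r s.
  by lia.
have TZ : of_type Pi (fun r s => (r < 0) || (0 <= s)) (X + iC R *: A).
  have -> : X + iC R *: A = u *m conjm (X - iC R *: A) *m conjm u
                            - (u *m conjm X - X *m u) *m conjm u.
    have -> : conjm (X - iC R *: A) = conjm X + iC R *: conjm A.
      rewrite conjmB conjmZ -scaleNr; congr (_ + _ *: _).
      by rewrite /iC /= ; congr Complex; rewrite ?oppr0 ?opprK.
    have uA : u *m (iC R *: conjm A) *m conjm u = iC R *: A.
      rewrite -scalemxAr -scalemxAl; congr (_ *: _).
      rewrite cu /A !conjmM Nreal conjm_inv /u -!mulmxA.
      by rewrite !mulKVmx.
    rewrite mulmxDr !mulmxDl uA mulNmx -[X *m u *m _]mulmxA ucu mulmx1 opprB.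
    by rewrite [RHS]addrC addrA subrK.
  apply: of_typeD; last apply: of_typeN.
    (* A factor of type [PU] either keeps the bidegree or lowers both indices. With the added bound
       [r <= 0], lowering always gives [r < 0], so the condition survives the second factor. *)
    apply: (of_typeM HI (fun r s => ((r < 0) || (0 <= s)) && (r <= 0)) PU) Tcu.
      by move=> r s r' s'; rewrite /PU; lia.
    apply: (of_typeM HI PU (fun r s => (0 <= s) && (r + s <= 0))) TT => //.
    by move=> r s r' s'; rewrite /PU; lia.
  apply: (of_typeM HI (fun r s => (r < 0) && (s < 0)) PU) Tcu => //.
  by move=> r s r' s'; rewrite /PU; lia.
(* These coefficients recover [A] from [X]: [T0] gives A = -iX where [r < 0], and [TZ] gives A = iX
   where [r >= 0 > s]. The remainder [B] is the (0,0)-component of [A]. *)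
pose c (r s : int) : R[i] := if r < 0 then - iC R else if s < 0 then iC R else 0.
pose Ds := \sum_(r <- zrange K) \sum_(s <- zrange K) c r s *: D r s.
pose B := A - Ds.
have ii : iC R * iC R = -1.
  by rewrite /iC /GRing.mul /=; congr Complex; rewrite ?mulr0 ?mul0r ?mulr1 ?sub0r ?addr0 ?oppr0.
have TB : of_type Pi (fun r s => (r == 0) && (s == 0)) B.
  move=> p q e f ne; rewrite /B linearB /= mulmxBr mulmxBl (rs_component HI _ _ _ c _ _ _ _ HD).
  rewrite /c; case: ltP => [r0|r0].
    have := T0 p q e f; rewrite leNgt r0 => /(_ isT)/eqP.
    rewrite linearB linearZ /= mulmxBr mulmxBl -scalemxAr -scalemxAl subr_eq0 => /eqP ->.
    by rewrite scalerA mulNr ii opprK scale1r subrr.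
  case: ltP => [s0|s0].
    have := TZ p q e f; rewrite !leNgt s0 ltNge r0 => /(_ isT)/eqP.
    rewrite linearD linearZ /= mulmxDr mulmxDl -scalemxAr -scalemxAl addr_eq0 => /eqP ->.
    by rewrite scalerN scalerA ii scaleN1r opprK subrr.
  (* With both indices nonnegative and not both zero, [r + s > 0], which preservation of [W]
     forbids. *)
  rewrite scale0r subr0; case: AgC => /(preservesW_type HI) -> //.
  by move: ne; lia.
have BgC : in_gC W S B.
  rewrite /B addrC -scaleN1r; apply: in_gCZD AgC.
  have [_ [Drs _]] := HD.
  by apply: in_gC_sum => r; apply: in_gC_sum => s; apply: in_gCZ; case: (Drs r s).
pose D' r s := c r s *: D r s + (if (r == 0) && (s == 0) then B else 0).
exists K, D'; split; [split; [|split]|].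
- move=> r s out; have [H _] := HD; rewrite /D' H// scaler0 add0r.
  by case: ifP => // /andP[/eqP r0 /eqP s0]; move: out; rewrite r0 s0; lia.
- move=> r s; have [_ [/(_ r s)[DgC DI] _]] := HD; split.
    rewrite /D'; apply: in_gCZD DgC _; case: ifP => _; [exact: BgC | exact: in_gC0].
  move=> p q; rewrite /D' /act linearD linearZ mulmxDr /= -scalemxAr.
  rewrite addmx_sub ?scalemx_sub// ?DI//.
  case: ifP => [/andP[/eqP-> /eqP->]|_]; last by rewrite trmx0 mulmx0 sub0mx.
  by rewrite !addr0 (of_type0P HI).
- have -> : \sum_(r <- zrange K) \sum_(s <- zrange K) D' r s = Ds + B.
    under eq_bigr do rewrite big_split /=.
    rewrite big_split /=; congr (_ + _).
    have z0 : 0 \in zrange K by rewrite mem_zrange.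
    rewrite (bigD1_seq 0 z0 (zrange_uniq K)) /= (bigD1_seq 0 z0 (zrange_uniq K)) /=.
    rewrite ?eqxx /= !big1 ?addr0// => [r r0|s s0]; last by rewrite (negPf s0).
    by rewrite big1// (negPf r0).
  by rewrite /B addrC subrK.
have [_ [_ XD]] := HD.
rewrite /X XD -sumrN; apply: eq_bigr => r _; rewrite -sumrN; apply: eq_bigr => s _.
(* The product of the two coefficients is -1 on each of the eta and Lambda parts. In the remaining
   bidegrees [D r s] vanishes by hypothesis (b) and L annihilates [B]. *)
rewrite /D' /Lcoef /c.
have [r0|r0] := ltP r 0.
  by rewrite /= lt_eqF//= addr0 scalerA mulrNN ii scaleN1r.
have [s0|s0] := ltP s 0.
  by rewrite [s == 0]lt_eqF// andbF addr0 /= scalerA ii scaleN1r.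
by rewrite D0 ?oppr0 ?andbF ?scale0r// !ltNge r0 s0.
Qed.
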